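(* Let $n\ge2$, $\xi\in\mathbb{S}^{n-1}$ and $f\in C^2_c(\mathbb{R}^n)$. Then $$\lim_{p\to n+}\Big(1-\frac np\Big)^{\frac pn}\|\xi\|^n_{\Pi^{*,n/p}_{p,n}f}=\frac1n\|\xi\|^n_{\Pi^*_nf},$$ i.e. $\lim_{p\to n+}\big[(1-\frac np)\int_0^\infty t^{-n^2/p}\|\Delta_{t\xi}f\|_{L^p}^n\frac{dt}{t}\big]^{p/n}=\frac1n\int_{\mathbb{R}^n}|\nabla f(x)\cdot\xi|^ndx$.
   Context: $\Delta_hf(x)=f(x+h)-f(x)$. $\|\xi\|^{sq}_{\Pi^{*,s}_{p,q}f}=\int_0^\infty t^{-sq}\|\Delta_{t\xi}f\|^q_{L^p}\frac{dt}{t}$ (here $s=n/p$, $q=n$), and $\|\xi\|^n_{\Pi^*_nf}=\int_{\mathbb{R}^n}|\nabla f(x)\cdot\xi|^ndx$. *)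

(* Defs.v *)
From HB Require Import structures.
From mathcomp Require Import all_boot all_order all_algebra.
From mathcomp Require Import all_classical all_reals all_analysis.
Set Implicit Arguments. Unset Strict Implicit. Unset Printing Implicit Defensive.
Import Order.TTheory GRing.Theory Num.Theory.
Import numFieldNormedType.Exports.
Local Open Scope classical_set_scope.
Local Open Scope ring_scope.

Section Defs.
Variable R : realType.

Definition basis_vec (n : nat) (i : 'I_n) : 'rV[R]_n := delta_mx 0 i.

Definition partial (n : nat) (i : 'I_n) (f : 'rV[R]_n -> R) (x : 'rV[R]_n) : R :=
  derive f x (basis_vec i).

Definition grad_dot (n : nat) (f : 'rV[R]_n -> R) (x xi : 'rV[R]_n) : R :=
  \sum_(i < n) partial i f x * xi 0 i.

Definition unit_sphere (n : nat) (xi : 'rV[R]_n) : Prop :=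
  \sum_(i < n) (xi 0 i) ^+ 2 = 1.

Definition C2c (n : nat) (f : 'rV[R]_n -> R) : Prop :=
  continuous f /\
  (forall i x, derivable f x (basis_vec i)) /\
  (forall i, continuous (partial i f)) /\
  (forall i j x, derivable (partial i f) x (basis_vec j)) /\
  (forall i j, continuous (partial j (partial i f))) /\
  compact (closure [set x | f x != 0]).

Definition Delta (n : nat) (h : 'rV[R]_n) (f : 'rV[R]_n -> R) (x : 'rV[R]_n) : R :=
  f (x + h) - f x.

(* Lebesgue integral over R^n of a (nonnegative) function, computed as the
   iterated one-dimensional Lebesgue integral (Tonelli). *)
Definition upd (x : nat -> R) (k : nat) (t : R) : nat -> R :=
  fun j => if j == k then t else x j.

Fixpoint iint (k : nat) (g : (nat -> R) -> \bar R) (x : nat -> R) : \bar R :=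
  match k with
  | 0 => g x
  | k'.+1 => (\int[@lebesgue_measure R]_(t in [set: R]) iint k' g (upd x k' t))%E
  end.

Definition int_Rn (n : nat) (F : 'rV[R]_n -> \bar R) : \bar R :=
  iint n (fun y => F (\row_(i < n) y i)) (fun _ => 0).

Definition Lp_norm (n : nat) (p : R) (g : 'rV[R]_n -> R) : \bar R :=
  (int_Rn (fun x => (`|g x| `^ p)%:E) `^ p^-1)%E.

(* ||xi||^{sq}_{Pi^{*,s}_{p,q} f} = int_0^oo t^{-sq} ||Delta_{t xi} f||_p^q dt/t *)
Definition Pi_star_spq (n : nat) (s p q : R) (f : 'rV[R]_n -> R) (xi : 'rV[R]_n)
  : \bar R :=
  (\int[@lebesgue_measure R]_(t in `]0%R, +oo[)
     ((t `^ (- (s * q)))%:E * (Lp_norm p (Delta (t *: xi) f)) `^ q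
      * (t^-1)%:E))%E.

Definition Pi_star_n (n : nat) (f : 'rV[R]_n -> R) (xi : 'rV[R]_n) : \bar R :=
  int_Rn (fun x => (`|grad_dot f x xi| ^+ n)%:E).

End Defs.

(* Main.v *)
Require Import Defs.
From HB Require Import structures.
From mathcomp Require Import all_boot all_order all_algebra.
From mathcomp Require Import all_classical all_reals all_analysis.
From mathcomp Require Import measurable_realfun ring lra.
Import Order.TTheory GRing.Theory Num.Theory.
Import numFieldNormedType.Exports.
Local Open Scope classical_set_scope.
Local Open Scope ring_scope.

(* Write e = p - n, G = |grad f . xi| and D_t = |Delta_{t xi} f| / t. Taylor's
   formula gives |D_t - G| <= C t uniformly, and |u^p - u^n| = O(e) on bounded
   intervals, so |D_t^p - G^n| = O(e + t), uniformly with common compact support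
   when t <= 1. Hence ||Delta_{t xi} f||_p^n = t^n (L + O(e + t)) with
   L = int G^n, while this norm stays bounded for t >= 1. Since
   int_0^1 t^(a-1) dt = 1/a for a = n (1 - n/p), multiplying the t-integral by
   1 - n/p gives L/n + O(e), and raising to the power p/n changes this by O(e). *)

(** The obstacle is measurability: [int_Rn] is an iterated integral, and neither its inner
    integrals, as functions of the outer variables, nor the norm of [Delta (t *: xi) f], as a
    function of [t], is shown to be measurable. Additivity and the usual monotonicity are therefore
    avoided. The only tool is a one-sided comparison [A <= k * B + g] with [A], [B] arbitrary
    nonnegative and [g] an explicit measurable error; a two-sided estimate comes from using it twice
    with the roles of [A] and [B] exchanged. The same device serves each coordinate of the space
    integral and the integral in [t]. All constants depend on [f], [xi] and [n] but not on [p],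
    which is confined to [n < p <= n + 1]. The upper bound keeps the perturbation of exponents at
    most 1, bounds [M^p] by [M^(n+1)], and gives [p <= n^2], from which the tail in [t] is dominated
    by [t^(-2)]. *)

Import HBNNSimple.

(** * Comparison of integrals without measurability *)

Section LowerIntegral.
Local Open Scope ereal_scope.

(* The integral of a nonnegative function is the supremum of the integrals of
   the simple functions [s] below it, and [s <= A] gives the measurable minorant
   [max (s - g) 0 / k] of [B]. *)
Lemma integral_le_affine (d : measure_display) (T : measurableType d) (R : realType)
    (mu : {measure set T -> \bar R}) (A B : T -> \bar R) (g : T -> R) (k : R) :
  (forall x, 0 <= A x) -> (forall x, 0 <= B x) ->
  measurable_fun setT g -> (forall x, (0 <= g x)%R) -> (0 < k)%R ->
  (forall x, A x <= k%:E * B x + (g x)%:E) ->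
  \int[mu]_x A x <= k%:E * \int[mu]_x B x + \int[mu]_x (g x)%:E.
Proof.
move=> A0 B0 mg g0 k0 AB; rewrite (ge0_integralTE _ A0).
apply: ge_ereal_sup => _ [s /= sA <-]; rewrite -integralT_nnsfun.
pose u x : R := (Num.max (s x - g x) 0)%R.
have u0 x : (0 <= u x)%R by rewrite le_max lexx orbT.
have mu_u : measurable_fun setT u.
  apply: measurable_maxr => //; apply: measurable_funB => //.
have meu : measurable_fun setT (EFin \o u) by exact/measurable_EFinP.
have meg : measurable_fun setT (EFin \o g) by exact/measurable_EFinP.
have mkinv : measurable_fun setT (fun x => (k^-1 * u x)%R).
  by apply: measurable_funM => //; exact: measurable_cst.
have uB x : (k^-1 * u x)%:E <= B x.
  have := B0 x; have := AB x; have := sA x.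
  case: (B x) => [b||]; [|by move=> *; rewrite leey|by []].
  rewrite -EFinM -EFinD => sa /(le_trans sa); rewrite !lee_fin => ab b0.
  by rewrite ler_pdivrMl// ge_max mulr_ge0 ?(ltW k0)// andbT lerBlDr.
(* Only [s], [u] and [g] occur here, and all three are measurable, so additivity is legitimate; [A]
   and [B] enter only through the suprema defining their integrals. *)
have le1 : \int[mu]_x (s x)%:E <= \int[mu]_x (u x)%:E + \int[mu]_x (g x)%:E.
  rewrite -ge0_integralD//; last 2 first.
  - by move=> x _; rewrite lee_fin.
  - by move=> x _; rewrite lee_fin.
  apply: ge0_le_integral => //.
  - by move=> x _; rewrite lee_fin.
  - exact/measurable_EFinP.
  - exact: emeasurable_funD.
  - by move=> x _; rewrite -EFinD lee_fin -lerBlDr le_max lexx.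
apply: (le_trans le1); apply: leeD => //.
have -> : \int[mu]_x (u x)%:E = k%:E * \int[mu]_x (k^-1 * u x)%:E.
  rewrite -ge0_integralZl_EFin//.
  - by apply: eq_integral => x _; rewrite -EFinM mulrA divff ?mul1r// gt_eqF.
  - by move=> x _; rewrite lee_fin mulr_ge0 ?invr_ge0 ?(ltW k0).
  - exact/measurable_EFinP.
  - exact: ltW.
rewrite lee_pmul2l//.
have ku0 x : 0 <= (k^-1 * u x)%:E by rewrite lee_fin mulr_ge0 ?invr_ge0 ?(ltW k0).
rewrite (ge0_integralTE _ ku0) (ge0_integralTE _ B0).
apply: le_ereal_sup => _ [s' /= s'A <-]; exists s' => //= x.
exact: le_trans (s'A x) (uB x).
Qed.

End LowerIntegral.

(** * Iterated integrals with an error supported in a cube *)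

Section BoxIntegral.
Variable R : realType.

Definition box_ind (r : R) (a : nat -> R) (i : nat) (t : R) : R :=
  \1_(`[a i - r, a i + r]) t.

(** The indicator of the cube in the coordinates from [k] on, that is, those over which [iint k] has
    not yet integrated. *)
Definition box_tail (r : R) (a : nat -> R) (n k : nat) (x : nat -> R) : R :=
  \prod_(k <= i < n) box_ind r a i (x i).

Lemma box_tail_ge0 r a n k x : 0 <= box_tail r a n k x.
Proof. by apply: prodr_ge0 => i _; rewrite /box_ind indicE ler0n. Qed.

Lemma box_tail_upd r a n k x t : (k < n)%N ->
  box_tail r a n k (upd x k t) = box_ind r a k t * box_tail r a n k.+1 x.
Proof.
move=> kn; rewrite /box_tail big_ltn// /upd eqxx; congr (_ * _).
by apply: eq_big_nat => i /andP[ki _]; rewrite gtn_eqF.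
Qed.

Local Open Scope ereal_scope.

Lemma iint_ge0 k (G : (nat -> R) -> \bar R) x :
  (forall y, 0 <= G y) -> 0 <= iint k G x.
Proof.
by move=> G0; elim: k x => [|k IH] x //=; apply: integral_ge0 => t _.
Qed.

Lemma iint0 k (x : nat -> R) : iint k (fun=> 0) x = 0.
Proof. by elim: k x => [//|k IH] x /=; under eq_integral do rewrite IH; rewrite integral0. Qed.

(** Induction on the number of integrated coordinates: each step applies the one-dimensional
    comparison, and the error, being a multiple of an interval indicator in the new variable, stays
    explicit and measurable while gaining a factor [2r]. *)
Lemma iint_le_affine (n : nat) (A B : (nat -> R) -> \bar R) (a : nat -> R) (r c q : R) :
  (forall y, 0 <= A y) -> (forall y, 0 <= B y) ->
  (0 <= r)%R -> (0 <= c)%R -> (0 < q)%R ->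
  (forall y, A y <= q%:E * B y + (c * box_tail r a n 0 y)%:E) ->
  forall k, (k <= n)%N -> forall x,
  iint k A x <= q%:E * iint k B x + (c * (r *+ 2) ^+ k * box_tail r a n k x)%:E.
Proof.
move=> A0 B0 r0 c0 q0 AB; elim => [_ x|k IH kn x] /=.
  by rewrite expr0 mulr1.
set K := (c * (r *+ 2) ^+ k * box_tail r a n k.+1 x)%R.
have K0 : (0 <= K)%R by rewrite !mulr_ge0 ?box_tail_ge0// exprn_ge0// mulrn_wge0.
have mb : measurable_fun setT (box_ind r a k).
  by apply: measurable_indic; exact: measurable_itv.
have b0 t : (0 <= box_ind r a k t)%R by rewrite /box_ind indicE ler0n.
have := @integral_le_affine _ _ R lebesgue_measure
  (fun t => iint k A (upd x k t)) (fun t => iint k B (upd x k t))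
  (fun t => (K * box_ind r a k t)%R) q.
have -> : \int[lebesgue_measure]_t (K * box_ind r a k t)%:E =
    (c * (r *+ 2) ^+ k.+1 * box_tail r a n k.+1 x)%:E :> \bar R.
  under eq_integral do rewrite EFinM.
  rewrite ge0_integralZl_EFin//; last 2 first.
    by move=> t _; rewrite lee_fin.
    exact/measurable_EFinP.
  rewrite integral_indic//= setIT.
  rewrite lebesgue_measure_itv/= lte_fin.
  have -> : (if (a k - r < a k + r)%R then (a k + r)%:E - (a k - r)%:E else 0)
     = (r *+ 2)%:E :> \bar R.
    case: ifPn => [_|]; first by rewrite -EFinB opprB addrC addrA subrK mulr2n.
    rewrite -leNgt => rr; suff -> : r = 0%R by rewrite mul0rn.
    by apply/eqP; rewrite eq_le r0 andbT; lra.
  by rewrite -EFinM /K exprS; congr EFin; ring.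
apply => //.
- by move=> t; exact: iint_ge0.
- by move=> t; exact: iint_ge0.
- by apply: measurable_funM => //; exact: measurable_cst.
- by move=> t; rewrite mulr_ge0.
- move=> t; apply: le_trans (IH (ltnW kn) _) _; rewrite leeD2l// lee_fin.
  by rewrite box_tail_upd// le_eqVlt; apply/orP; left; apply/eqP; rewrite /K; ring.
Qed.

End BoxIntegral.

(** * Elementary inequalities for powers *)

Section PowerEstimates.
Variable R : realType.
Implicit Types u M m e : R.

(** Everything follows from [1 + y <= exp y]. For [u <= 1] it gives [1 - u^e <= e / u], and
    [u^m <= u] (as [1 <= m]) cancels the singularity at 0. For [u >= 1] it gives
    [u^e - 1 <= e * ln u * u^e <= e * u^2], using [ln u <= u] and [e <= 1]; this is the source of
    the exponent [m + 2]. *)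
Lemma powR_close u M m e : 0 <= u -> u <= M -> 1 <= M -> 1 <= m ->
  0 <= e -> e <= 1 -> `|u `^ (m + e) - u `^ m| <= e * M `^ (m + 2).
Proof.
move=> u0 uM M1 m1 e0 e1.
have M0 : 0 < M by lra.
have RHS0 : 0 <= e * M `^ (m + 2) by rewrite mulr_ge0// powR_ge0.
move: u0; rewrite le_eqVlt => /predU1P[<-|u0].
  by rewrite !powR0 ?subrr ?normr0//; apply/eqP; lra.
have un0 : u != 0 by rewrite gt_eqF.
have um0 : 0 <= u `^ m by exact: powR_ge0.
rewrite powRD ?un0 ?implybT// -{2}[u `^ m]mulr1 -mulrBr normrM (ger0_norm um0).
have ueE : u `^ e = expR (e * ln u) by rewrite /powR (negbTE un0).
have [u1|/ltW u1] := leP u 1.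
  have lnu : ln u <= 0 by exact: ln_le0.
  have ue1 : u `^ e <= 1 by rewrite ueE -expR0 ler_expR mulr_ge0_le0.
  rewrite ler0_norm ?subr_le0// opprB.
  have h1 : 1 - u `^ e <= e * (- ln u).
    by have := expR_ge1Dx (e * ln u); rewrite -ueE; lra.
  have h2 : - ln u <= u^-1.
    by have := expR_ge1Dx (- ln u); rewrite expRN lnK ?posrE//; lra.
  have h3 : u `^ m <= u by apply: ge1r_powR => //; rewrite u0.
  apply: (@le_trans _ _ (u * (e * u^-1))).
    apply: ler_pM => //; first by rewrite subr_ge0.
    by apply: (le_trans h1); rewrite ler_wpM2l.
  rewrite mulrCA divff// ler_wpM2l//; apply: (@le_trans _ _ (1 `^ (m + 2))); first by rewrite powR1.
  apply: ge0_ler_powR => //.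
  - lra.
  - by rewrite nnegrE.
  - by rewrite nnegrE ltW.
have lnu : 0 <= ln u by exact: ln_ge0.
have ue1 : 1 <= u `^ e by rewrite ueE -expR0 ler_expR mulr_ge0.
rewrite ger0_norm ?subr_ge0//.
have ueu : u `^ e <= u by exact: ler1_powR.
have h1 : u `^ e - 1 <= e * ln u * u `^ e.
  have := expR_ge1Dx (- (e * ln u)); rewrite expRN -ueE => h.
  have ue0 : 0 < u `^ e by lra.
  have : (1 - e * ln u) * u `^ e <= (u `^ e)^-1 * u `^ e by rewrite ler_pM2r.
  by rewrite mulVf ?gt_eqF//; lra.
have h2 : ln u <= u by have := expR_ge1Dx (ln u); rewrite lnK ?posrE//; lra.
have h3 : u `^ e - 1 <= e * u ^+ 2.
  apply: (le_trans h1); rewrite expr2 mulrA; apply: ler_pM => //.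
  - by rewrite mulr_ge0.
  - exact: powR_ge0.
  - by rewrite ler_wpM2l.
apply: (@le_trans _ _ (u `^ m * (e * u ^+ 2))); first by rewrite ler_wpM2l.
rewrite mulrCA ler_wpM2l// -powR_mulrn ?(ltW u0)// -powRD ?un0 ?implybT//.
by apply: ge0_ler_powR => //; rewrite ?nnegrE ?(ltW u0) ?(ltW M0)//; lra.
Qed.

Lemma exprn_lipschitz (a b M : R) (k : nat) : 0 <= a -> a <= M -> 0 <= b -> b <= M ->
  1 <= M -> `|a ^+ k - b ^+ k| <= k%:R * M ^+ k * `|a - b|.
Proof.
move=> a0 aM b0 bM M1; elim: k => [|k IH].
  by rewrite !expr0 subrr normr0 mul0r mul0r.
have -> : a ^+ k.+1 - b ^+ k.+1 = a * (a ^+ k - b ^+ k) + b ^+ k * (a - b).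
  by rewrite !exprS; ring.
apply: (le_trans (ler_normD _ _)); rewrite !normrM (ger0_norm a0).
rewrite (ger0_norm (exprn_ge0 _ b0)).
have Mk : 0 <= M ^+ k by apply: exprn_ge0; lra.
have -> : k.+1%:R * M ^+ k.+1 * `|a - b| =
    M * (k%:R * M ^+ k * `|a - b|) + M * M ^+ k * `|a - b|.
  by rewrite exprS -natr1; ring.
apply: lerD; first by apply: ler_pM.
apply: ler_wpM2r => //; apply: (@le_trans _ _ (M ^+ k)).
  by apply: lerXn2r => //; rewrite nnegrE; lra.
by rewrite ler_peMl.
Qed.

End PowerEstimates.

(** * Integrals of powers on []0, 1]] and [[1, +oo[] *)

Section PowerIntegrals.
Variable R : realType.
Notation mu := (@lebesgue_measure R).

Lemma is_derive_powR_primitive (a x : R) : a != 0 -> 0 < x ->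
  is_derive x 1 (fun t => a^-1 * t `^ a) (x `^ (a - 1)).
Proof.
move=> a0 x0; have h := is_derive1_powR a x0.
have := @is_deriveZ _ _ _ (fun t : R => t `^ a) a^-1 x 1 _ h.
by rewrite /GRing.scale/= mulrA mulVf// mul1r.
Qed.

Lemma powR_continuous (b x : R) : 0 < x -> {for x, continuous (fun t => t `^ b)}.
Proof.
move=> x0; apply: differentiable_continuous; apply/derivable1_diffP.
by apply: derivable_powR; rewrite in_itv/= x0.
Qed.

Lemma integral_powR_segment (a e : R) : 0 < a -> 0 < e < 1 ->
  (\int[mu]_(x in `[e, 1%R]) (x `^ (a - 1))%:E = (a^-1 - a^-1 * e `^ a)%:E)%E.
Proof.
move=> a0 /andP[e0 e1]; have an0 : a != 0 by rewrite gt_eqF.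
rewrite (@continuous_FTC2 _ (fun x => x `^ (a - 1)) (fun t => a^-1 * t `^ a))//.
- by rewrite powR1 mulr1 -EFinB.
- apply: continuous_in_subspaceT => x; rewrite inE/= in_itv/= => /andP[ex _].
  by apply: powR_continuous; exact: lt_le_trans ex.
- split.
  + move=> x; rewrite in_itv/= => /andP[ex _].
    by have [] := is_derive_powR_primitive _ x an0 (lt_trans e0 ex).
  + apply: cvg_at_right_filter; apply: cvgM; first exact: cvg_cst.
    exact: powR_continuous.
  + apply: cvg_at_left_filter; apply: cvgM; first exact: cvg_cst.
    exact: powR_continuous.
- move=> x; rewrite in_itv/= => /andP[ex _].
  rewrite derive1E; have h := is_derive_powR_primitive _ x an0 (lt_trans e0 ex).
  exact: derive_val.
Qed.

Lemma integral_powR01 (a : R) : 0 < a ->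
  (\int[mu]_(x in `]0%R, 1%R]) (x `^ (a - 1))%:E = (a^-1)%:E)%E.
Proof.
move=> a0.
(* The index shift by 2 keeps the left endpoint strictly below 1, as [integral_powR_segment]
   requires. *)
pose F (i : nat) : set R := [set` `[(i.+2%:R : R)^-1, 1]].
have mp (D : set R) : measurable_fun D (fun x : R => (x `^ (a - 1))%:E).
  by apply/measurable_EFinP; apply: measurable_funS (measurable_powR (a - 1)).
have FU : \bigcup_i F i = [set` `]0%R, 1%R]].
  apply/seteqP; split => x /=.
    move=> [i _]; rewrite /F /= !in_itv/= => /andP[ix ->]; rewrite andbT.
    by apply: lt_le_trans ix; rewrite invr_gt0.
  rewrite in_itv/= => /andP[x0 x1].
  exists (Num.truncn x^-1) => //; rewrite /F /= in_itv/= x1 andbT.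
  rewrite invf_ple ?posrE// (le_trans (ltW (truncnS_gt _)))//.
  by rewrite ler_nat.
have h : (\int[mu]_(x in F i) (x `^ (a - 1))%:E)%E @[i --> \oo] -->
   (\int[mu]_(x in `]0%R, 1%R]) (x `^ (a - 1))%:E)%E.
  rewrite -FU; apply: ge0_nondecreasing_set_cvg_integral.
  - move=> i j ij; apply/subsetPset => x; rewrite /F /= !in_itv/= => /andP[ix ->].
    rewrite andbT; apply: le_trans ix.
    by rewrite lef_pV2 ?posrE// ler_nat.
  - by move=> i; exact: measurable_itv.
  - by move=> i; exact: mp.
  - by move=> i x _; rewrite lee_fin powR_ge0.
have hF i : (\int[mu]_(x in F i) (x `^ (a - 1))%:E =
    (a^-1 - a^-1 * (i.+2%:R^-1) `^ a)%:E)%E.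
  by apply: integral_powR_segment; rewrite ?invr_gt0 ?invf_lt1 ?ltr0n ?ltr1n.
move: h; rewrite (funext hF) => h; apply: (cvg_unique _ h) => //.
apply: cvg_EFin; first exact: nearW.
rewrite /comp/=.
rewrite -[X in _ --> X]subr0; apply: cvgB; first exact: cvg_cst.
rewrite -[X in _ --> X](mulr0 a^-1); apply: cvgM; first exact: cvg_cst.
have := @powR_cvg0 R a a0.
move=> /cvg_at_rightP; apply; split => //.
apply/gtr0_cvgV0; first by apply: nearW => i; rewrite ltr0n.
have := @cvgr_idn R; rewrite -(cvg_shiftn 2) => hh.
by under eq_fun do rewrite -addn2.
Qed.

Lemma integral_powRN2 :
  (\int[mu]_(x in `[1%R, +oo[) (x `^ (- 2))%:E = 1%:E)%E.
Proof.
have n10 : -1 != 0 :> R by rewrite oppr_eq0 oner_eq0.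
have E2 : - 2 = -1 - 1 :> R by lra.
have d (x : R) : 0 < x -> is_derive x 1 (fun t : R => (-1)^-1 * t `^ (-1)) (x `^ (- 2)).
  by rewrite E2; exact: is_derive_powR_primitive.
rewrite (@ge0_continuous_FTC2y _ (fun x => x `^ (- 2)) (fun t => (-1)^-1 * t `^ (-1)) _ 0).
- by rewrite powR1 mulr1 invrN1 -EFinB sub0r opprK.
- by move=> x _; exact: powR_ge0.
- apply: continuous_in_subspaceT => x; rewrite inE/= in_itv/= andbT => ex.
  by apply: powR_continuous; exact: lt_le_trans ex.
- rewrite -[X in _ --> X](mulr0 (-1)^-1); apply: cvgM; first exact: cvg_cst.
  have h : x^-1 @[x --> +oo] --> (0 : R).
    apply/gtr0_cvgV0 => //.
    exact: nbhs_pinfty_gt.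
  apply: cvg_trans h; apply: near_eq_cvg; near=> x.
  by rewrite powR_inv1//; near: x; exact: nbhs_pinfty_ge.
- by move=> x x1; have [] := d x (lt_trans ltr01 x1).
- apply: cvg_at_right_filter; apply: cvgM; first exact: cvg_cst.
  exact: powR_continuous.
- move=> x; rewrite in_itv/= andbT => x1.
  rewrite derive1E; have h := d x (lt_trans ltr01 x1).
  exact: derive_val.
Unshelve. all: by end_near. Qed.

End PowerIntegrals.

(** * Increments through partial derivatives, and bounds from compact support *)

Section Calculus.
Variables (R : realType) (n : nat).
Implicit Types (g f : 'rV[R]_n -> R) (x h xi : 'rV[R]_n).

Lemma is_derive_line g (y : 'rV[R]_n) (i : 'I_n) (s : R) :
  derivable g (y + s *: basis_vec R i) (basis_vec R i) ->
  is_derive s 1 (fun s => g (y + s *: basis_vec R i))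
    (partial i g (y + s *: basis_vec R i)).
Proof.
have E : (fun h : R => h^-1 *: (g (y + (h *: 1 + s) *: basis_vec R i)
           - g (y + s *: basis_vec R i))) =
   (fun h : R => h^-1 *: (g (h *: basis_vec R i + (y + s *: basis_vec R i))
           - g (y + s *: basis_vec R i))).
  apply/funext => h; congr (_ *: (g _ - _)).
  by rewrite scalerDl addrCA /GRing.scale/= mulr1.
move=> dg; split.
  by rewrite /derivable/= E.
by rewrite /partial /derive/= E.
Qed.

Lemma partial_MVT g x (i : 'I_n) (t : R) :
  (forall y, derivable g y (basis_vec R i)) ->
  exists2 s : R, `|s| <= `|t| &
    g (x + t *: basis_vec R i) - g x = partial i g (x + s *: basis_vec R i) * t.
Proof.
move=> dg.
pose phi s := g (x + s *: basis_vec R i).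
have dphi (s : R) : is_derive s 1 phi (partial i g (x + s *: basis_vec R i)).
  exact: is_derive_line.
have cphi : continuous phi.
  move=> s; apply: differentiable_continuous; apply/derivable1_diffP.
  by have [] := dphi s.
have phi0 : phi 0 = g x by rewrite /phi scale0r addr0.
have [t0|/ltW t0] := leP 0 t.
  have [|c] := @MVT_segment _ phi _ 0 t t0 (fun s _ => dphi s).
    exact: continuous_subspaceT.
  rewrite in_itv/= => /andP[c0 ct]; rewrite phi0 subr0 => E.
  by exists c => //; rewrite !ger0_norm.
have [|c] := @MVT_segment _ phi _ t 0 t0 (fun s _ => dphi s).
  exact: continuous_subspaceT.
rewrite in_itv/= => /andP[ct c0]; rewrite phi0 sub0r mulrN => E.
exists c; first by rewrite !ler0_norm// lerN2.
by rewrite -[RHS]opprK -E opprB.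
Qed.

(** Moving from [x] to [x + h] one coordinate at a time turns the increment into a telescoping sum
    of one-variable increments, each given by the mean value theorem. Only partial derivatives are
    involved, which is what [C2c] supplies. *)
Lemma increment_partials g x h :
  (forall i y, derivable g y (basis_vec R i)) ->
  exists z : 'I_n -> 'rV[R]_n,
    (forall i j, `|(z i - x) 0 j| <= `|h 0 j|) /\
    g (x + h) - g x = \sum_(i < n) partial i g (z i) * h 0 i.
Proof.
move=> dg.
(* [H k] keeps the first [k] coordinates of [h]: these are the corners of the path. *)
pose H (k : nat) : 'rV[R]_n := \row_j (if (j < k)%N then h 0 j else 0).
have H0 : H 0%N = 0 by apply/rowP => j; rewrite !mxE.
have Hn : H n = h by apply/rowP => j; rewrite !mxE ltn_ord.
have HS (i : 'I_n) : H i.+1 = H i + h 0 i *: basis_vec R i.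
  apply/rowP => j; rewrite !mxE eqxx/= ltnS leq_eqVlt.
  have [->|ij] := eqVneq j i; first by rewrite eqxx/= ltnn add0r mulr1.
  by rewrite (negbTE (ij : (j : nat) != i)) /= mulr0 addr0.
have /choice[s hs] : forall i : 'I_n, exists s : R, `|s| <= `|h 0 i| /\
    g (x + H i + h 0 i *: basis_vec R i) - g (x + H i) =
    partial i g (x + H i + s *: basis_vec R i) * h 0 i.
  by move=> i; have [s] := partial_MVT g (x + H i) i (h 0 i) (dg i); exists s.
exists (fun i : 'I_n => x + H i + s i *: basis_vec R i); split.
  move=> i j; have [si _] := hs i.
  rewrite !mxE eqxx/=.
  rewrite [X in `|X|](_ : _ = (if (j < i)%N then h 0 j else 0) + s i * (j == i)%:R);
    last by ring.
  have [->|ij] := eqVneq j i; first by rewrite ltnn add0r mulr1.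
  by rewrite mulr0 addr0; case: ifP => // _; rewrite normr0.
have -> : g (x + h) - g x = g (x + H n) - g (x + H 0%N) by rewrite Hn H0 addr0.
rewrite -(telescope_sumr (fun k => g (x + H k)))// big_mkord.
apply: eq_bigr => i _; have [_ <-] := hs i.
by rewrite HS addrA.
Qed.

(** The l^1 norm, natural for paths parallel to the axes. *)
Definition sum_abs h : R := \sum_(i < n) `|h 0 i|.

Lemma sum_abs_ge0 h : 0 <= sum_abs h.
Proof. exact: sumr_ge0. Qed.

Lemma sum_absZ (t : R) h : sum_abs (t *: h) = `|t| * sum_abs h.
Proof. by rewrite /sum_abs mulr_sumr; apply: eq_bigr => i _; rewrite mxE normrM. Qed.

Lemma bounded_partials_lipschitz g (M : R) x h :
  (forall i y, derivable g y (basis_vec R i)) ->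
  (forall i y, `|partial i g y| <= M) ->
  `|g (x + h) - g x| <= M * sum_abs h.
Proof.
move=> dg gM; have [z [_ ->]] := increment_partials g x h dg.
apply: (le_trans (ler_norm_sum _ _ _)); rewrite /sum_abs mulr_sumr.
by apply: ler_sum => i _; rewrite normrM ler_wpM2r.
Qed.

(** The mean value argument is used twice in place of a second-order expansion: once for [f],
    producing its partials at points [z i], and once for each partial, to replace [z i] by [x]. The
    coordinates of [z i - x] are bounded by those of [h], whence the square. *)
Lemma increment_grad_dot f (M : R) x h :
  (forall i y, derivable f y (basis_vec R i)) ->
  (forall i j y, derivable (partial i f) y (basis_vec R j)) ->
  (forall i j y, `|partial j (partial i f) y| <= M) ->
  `|f (x + h) - f x - grad_dot f x h| <= M * sum_abs h ^+ 2.
Proof.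
move=> df ddf fM; have [z [zx ->]] := increment_partials f x h df.
rewrite /grad_dot -sumrB; apply: (le_trans (ler_norm_sum _ _ _)).
rewrite expr2 mulrA {2}/sum_abs mulr_sumr.
apply: ler_sum => i _; rewrite -mulrBl normrM ler_wpM2r//.
have M0 : 0 <= M by apply: le_trans (fM i i x).
have := bounded_partials_lipschitz (partial i f) M x (z i - x) (ddf i) (fM i).
rewrite addrCA subrr addr0 => /le_trans; apply.
by rewrite ler_wpM2l//; apply: ler_sum => j _; exact: zx.
Qed.

Lemma partial_support g (K : set 'rV[R]_n) i :
  closed K -> (forall x, ~ K x -> g x = 0) -> forall x, ~ K x -> partial i g x = 0.
Proof.
move=> cK gK x Kx; rewrite /partial (@near_eq_derive _ _ _ g (cst 0)).
  exact: derive_cst.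
have oK : open (~` K) by exact: closed_openC.
have := open_nbhs_nbhs (conj oK Kx).
by apply: filterS => y /= /gK.
Qed.

Lemma compact_support_bounded g (K : set 'rV[R]_n) :
  compact K -> continuous g -> (forall x, ~ K x -> g x = 0) ->
  exists M, forall x, `|g x| <= M.
Proof.
move=> cK cg gK.
have : compact (g @` K).
  by apply: continuous_compact => //; exact: continuous_subspaceT.
move=> /compact_bounded/ex_strict_bound_gt0[M _ hM].
exists (Num.max M 0) => x; have [Kx|/gK ->] := pselect (K x).
  by rewrite le_max ltW// (hM (g x))//; exists x.
by rewrite normr0 le_max lexx orbT.
Qed.

Lemma finite_bound (I : finType) (b : I -> R -> Prop) :
  (forall i M M', M <= M' -> b i M -> b i M') ->
  (forall i, exists M, b i M) -> exists M, forall i, b i M.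
Proof.
move=> mono /choice[m hm]; exists (\sum_i `|m i|) => i.
apply: mono (hm i); apply: (le_trans (ler_norm _)).
by rewrite (bigD1 i)//= lerDl sumr_ge0.
Qed.

Lemma compact_box (K : set 'rV[R]_n) : compact K ->
  exists r : R, forall x, K x -> forall i, `|x 0 i| <= r.
Proof.
move=> /compact_bounded/ex_strict_bound_gt0[M _ hM]; exists M => x Kx i.
apply: le_trans (ltW (hM x Kx)).
have -> : `|x| = mx_norm x by [].
rewrite mx_normrE; exact: (le_bigmax _ (fun ij : 'I_1 * 'I_n => `|x ij.1 ij.2|) (0, i)).
Qed.

Lemma C2c_bounds f : C2c f -> exists M r : R,
  [/\ forall x, `|f x| <= M,
      forall i x, `|partial i f x| <= M,
      forall i j x, `|partial j (partial i f) x| <= M,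
      forall x, f x != 0 -> forall j, `|x 0 j| <= r &
      forall i x, partial i f x != 0 -> forall j, `|x 0 j| <= r].
Proof.
move=> [cf [df [cdf [ddf [cddf cK]]]]].
set K := closure _ in cK.
have clK : closed K by exact: closed_closure.
have fK x : ~ K x -> f x = 0.
  by move=> Kx; apply: contrapT => /eqP fx; apply: Kx; exact: subset_closure.
have dfK i := partial_support f K i clK fK.
have ddfK i j := partial_support _ K j clK (dfK i).
have [M0 hM0] := compact_support_bounded f K cK cf fK.
have [||M1 hM1] := @finite_bound 'I_n (fun i M => forall x, `|partial i f x| <= M).
  by move=> i M M' MM' h x; exact: le_trans MM'.
  by move=> i; exact: compact_support_bounded (dfK i).
have [||M2 hM2] := @finite_bound ('I_n * 'I_n)%type
    (fun ij M => forall x, `|partial ij.2 (partial ij.1 f) x| <= M).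
  by move=> i M M' MM' h x; exact: le_trans MM'.
  by move=> [i j]; exact: compact_support_bounded (ddfK i j).
have [r hr] := compact_box K cK.
exists (Num.max M0 (Num.max M1 M2)), r; split.
- by move=> x; rewrite le_max hM0.
- by move=> i x; rewrite !le_max hM1 orbT.
- by move=> i j x; rewrite !le_max (hM2 (i, j)) !orbT.
- by move=> x fx; apply: hr; exact: subset_closure.
- move=> i x /eqP fx; apply: hr; apply: contrapT => Kx; apply: fx; exact: dfK.
Qed.

End Calculus.

(** * Comparison and bounds for [int_Rn] *)

Section IntRn.
Variables (R : realType) (n : nat).

Lemma box_tail1 (r : R) (a y : nat -> R) (m : nat) :
  (forall i, (i < m)%N -> `|y i - a i| <= r) -> box_tail R r a m 0 y = 1.
Proof.
move=> h; rewrite /box_tail big_nat_cond big1// => i /andP[/andP[_ im] _].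
rewrite /box_ind indicE mem_set//= in_itv/=.
by have := h i im; rewrite ler_norml => /andP[h1 h2]; apply/andP; split; lra.
Qed.

Local Open Scope ereal_scope.

Lemma int_Rn_le_affine (A B : 'rV[R]_n -> \bar R) (a : 'rV[R]_n) (r c q : R) :
  (forall x, 0 <= A x) -> (forall x, 0 <= B x) ->
  (0 <= r)%R -> (0 <= c)%R -> (0 < q)%R ->
  (forall x : 'rV[R]_n, (forall i, (`|x ord0 i - a ord0 i| <= r)%R) -> A x <= q%:E * B x + c%:E) ->
  (forall x : 'rV[R]_n, ~ (forall i, (`|x ord0 i - a ord0 i| <= r)%R) -> A x <= q%:E * B x) ->
  int_Rn A <= q%:E * int_Rn B + (c * (r *+ 2) ^+ n)%:E.
Proof.
move=> A0 B0 r0 c0 q0 h1 h2.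
(* [iint] works with points indexed by all naturals, so the centre is extended by 0. *)
pose a' (i : nat) : R := oapp (fun j : 'I_n => a ord0 j) 0%R (insub i).
have a'E (j : 'I_n) : a' j = a ord0 j by rewrite /a' valK.
have := @iint_le_affine R n (fun y => A (\row_(i < n) y i))
  (fun y => B (\row_(i < n) y i)) a' r c q.
rewrite /int_Rn => h.
have -> : (c * (r *+ 2) ^+ n)%R =
    (c * (r *+ 2) ^+ n * box_tail R r a' n n (fun=> 0))%R :> R.
  by rewrite /box_tail big_geq// mulr1.
apply: h => // y; set x := (\row_(i < n) y i)%R.
have [xb|xb] := pselect (forall i, (`|x ord0 i - a ord0 i| <= r)%R).
  rewrite box_tail1 ?mulr1; first exact: h1.
  by move=> i im; have := xb (Ordinal im); rewrite mxE -a'E.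
apply: le_trans (h2 _ xb) _; rewrite leeDl// lee_fin.
by rewrite mulr_ge0// box_tail_ge0.
Qed.

Lemma int_Rn_ge0 (A : 'rV[R]_n -> \bar R) : (forall x, 0 <= A x) -> 0 <= int_Rn A.
Proof. by move=> A0; exact: iint_ge0. Qed.

Lemma int_Rn_le_box (A : 'rV[R]_n -> \bar R) (a : 'rV[R]_n) (r c : R) :
  (forall x, 0 <= A x) -> (0 <= r)%R -> (0 <= c)%R ->
  (forall x : 'rV[R]_n, (forall i, (`|x ord0 i - a ord0 i| <= r)%R) -> A x <= c%:E) ->
  (forall x : 'rV[R]_n, ~ (forall i, (`|x ord0 i - a ord0 i| <= r)%R) -> A x <= 0) ->
  int_Rn A <= (c * (r *+ 2) ^+ n)%:E.
Proof.
move=> A0 r0 c0 h1 h2.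
apply: le_trans (@int_Rn_le_affine A (fun=> 0) a r c 1 A0 _ r0 c0 ltr01 _ _) _ => //.
- by move=> x /h1; rewrite mule0 add0e.
- by move=> x /h2; rewrite mule0.
- by rewrite /int_Rn iint0 mule0 add0e.
Qed.

End IntRn.

(** * The integral in [t] *)

Section OuterIntegral.
Variable R : realType.
Local Open Scope ereal_scope.
Notation mu := (@lebesgue_measure R).

Lemma integral_patch (D : set R) (h : R -> R) :
  \int[mu]_x ((h \_ D) x)%:E = \int[mu]_(x in D) (h x)%:E.
Proof.
rewrite [RHS]integral_mkcond; apply: eq_integral => x _.
by rewrite !patchE; case: ifP.
Qed.

(** To be used with [al = n (1 - n/p)] and [e = p - n], both tending to 0. The main term and the
    error [c * e] carry the weight [t^(al-1)], of integral [1/al]; the other errors have bounded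
    integral, so multiplying by [al] makes them small. *)
Lemma outer_integral_estimate (H : R -> \bar R) (al l c e C : R) :
  (0 < al)%R -> (0 <= l)%R -> (0 <= c)%R -> (0 <= e)%R -> (0 <= C)%R ->
  (forall t, (0 < t)%R -> 0 <= H t) ->
  (forall t, (0 < t)%R -> (t <= 1)%R ->
     H t <= (l * t `^ (al - 1) + (c * e * t `^ (al - 1) + c))%:E) ->
  (forall t, (0 < t)%R -> (t <= 1)%R ->
     (l * t `^ (al - 1))%:E <= H t + (c * e * t `^ (al - 1) + c)%:E) ->
  (forall t, (1 < t)%R -> H t <= (C * t `^ (- 2))%:E) ->
  exists2 I : R, \int[mu]_(t in `]0%R, +oo[) H t = I%:E &
    (0 <= I)%R /\ (`|al * I - l| <= c * e + al * c + al * C)%R.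
Proof.
move=> al0 l0 c0 e0 C0 H0 Hu Hl Ht.
pose D0 : set R := [set` `]0%R, +oo[].
pose D1 : set R := [set` `]0%R, 1%R]].
pose D2 : set R := [set` `[1%R, +oo[].
pose e1 : R -> R := (fun t => (t `^ (al - 1))%R) \_ D1.
(* The overlap of [D1] and [D2] at 1 is harmless: in the upper bound the surplus term is
   nonnegative, and the lower bound uses [D1] alone. *)
pose e2 : R -> R := (fun=> (1%R : R)) \_ D1.
pose e3 : R -> R := (fun t => (t `^ (- 2))%R) \_ D2.
have mD0 : measurable D0 by exact: measurable_itv.
have mD1 : measurable D1 by exact: measurable_itv.
have mD2 : measurable D2 by exact: measurable_itv.
have m1 : measurable_fun setT e1.
  by apply/(measurable_restrictT _ mD1); apply: measurable_funS (measurable_powR _).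
have m2 : measurable_fun setT e2.
  by apply/(measurable_restrictT _ mD1); exact: measurable_cst.
have m3 : measurable_fun setT e3.
  by apply/(measurable_restrictT _ mD2); apply: measurable_funS (measurable_powR _).
have e10 t : (0 <= e1 t)%R by rewrite /e1 patchE; case: ifP => // _; exact: powR_ge0.
have e20 t : (0 <= e2 t)%R by rewrite /e2 patchE; case: ifP.
have e30 t : (0 <= e3 t)%R by rewrite /e3 patchE; case: ifP => // _; exact: powR_ge0.
have I1 : \int[mu]_t (e1 t)%:E = (al^-1)%:E by rewrite integral_patch integral_powR01.
have I2 : \int[mu]_t (e2 t)%:E = 1.
  rewrite integral_patch integral_cst//= mul1e lebesgue_measure_itv/= lte_fin ltr01.
  by rewrite -EFinB subr0.
have I3 : \int[mu]_t (e3 t)%:E = 1 by rewrite integral_patch integral_powRN2.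
have lin (a b d : R) : (0 <= a)%R -> (0 <= b)%R -> (0 <= d)%R ->
    \int[mu]_t (a * e1 t + (b * e2 t + d * e3 t))%:E = (a * al^-1 + (b + d))%:E.
  move=> a0 b0 d0.
  have Z (k : R) (h : R -> R) (v : R) : (0 <= k)%R -> (forall t, (0 <= h t)%R) ->
      measurable_fun setT h -> \int[mu]_t (h t)%:E = v%:E ->
      \int[mu]_t (k * h t)%:E = (k * v)%:E.
    move=> k0 h0 mh hv; under eq_integral do rewrite EFinM.
    rewrite ge0_integralZl_EFin ?hv//; last exact/measurable_EFinP.
    by move=> t _; rewrite lee_fin.
  have A (h1 h2 : R -> R) (v1 v2 : R) : (forall t, (0 <= h1 t)%R) ->
      (forall t, (0 <= h2 t)%R) -> measurable_fun setT h1 -> measurable_fun setT h2 ->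
      \int[mu]_t (h1 t)%:E = v1%:E -> \int[mu]_t (h2 t)%:E = v2%:E ->
      \int[mu]_t (h1 t + h2 t)%:E = (v1 + v2)%:E.
    move=> h10 h20 mh1 mh2 hv1 hv2; under eq_integral do rewrite EFinD.
    rewrite ge0_integralD// ?hv1 ?hv2//.
    - by move=> t _; rewrite lee_fin.
    - exact/measurable_EFinP.
    - by move=> t _; rewrite lee_fin.
    - exact/measurable_EFinP.
  have ma : measurable_fun setT (fun t => a * e1 t)%R.
    by apply: measurable_funM => //; exact: measurable_cst.
  have mb : measurable_fun setT (fun t => b * e2 t)%R.
    by apply: measurable_funM => //; exact: measurable_cst.
  have md : measurable_fun setT (fun t => d * e3 t)%R.
    by apply: measurable_funM => //; exact: measurable_cst.
  apply: (A) => //.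
  - by move=> t; rewrite mulr_ge0.
  - by move=> t; rewrite addr_ge0// mulr_ge0.
  - exact: measurable_funD.
  - exact: Z.
  - rewrite -[b in RHS]mulr1 -[d in RHS]mulr1; apply: (A) => //.
    + by move=> t; rewrite mulr_ge0.
    + by move=> t; rewrite mulr_ge0.
    + exact: Z.
    + exact: Z.
have meas (a b d : R) :
    measurable_fun setT (fun t => a * e1 t + (b * e2 t + d * e3 t))%R.
  have mZ (k : R) (h : R -> R) : measurable_fun setT h ->
      measurable_fun setT (fun t => k * h t)%R.
    by move=> mh; apply: measurable_funM => //; exact: measurable_cst.
  exact: measurable_funD (mZ a _ m1) (measurable_funD (mZ b _ m2) (mZ d _ m3)).
have pos (a b d t : R) : (0 <= a)%R -> (0 <= b)%R -> (0 <= d)%R ->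
    (0 <= a * e1 t + (b * e2 t + d * e3 t))%R.
  by move=> a0 b0 d0; rewrite !(addr_ge0, mulr_ge0).
have ce0 : (0 <= c * e)%R by rewrite mulr_ge0.
pose H' := H \_ D0.
have H'0 t : 0 <= H' t.
  rewrite /H' patchE; case: ifPn => //; rewrite inE /D0 /= in_itv/= andbT.
  exact: H0.
have up : \int[mu]_t H' t <= ((l + c * e) * al^-1 + (c + C))%:E.
  have := @integral_le_affine _ _ R mu H' (fun=> 0)
    (fun t => (l + c * e) * e1 t + (c * e2 t + C * e3 t))%R 1.
  rewrite lin//; last by rewrite addr_ge0.
  rewrite integral0 mule0 add0e; apply => //.
  - exact: meas.
  - by move=> t; apply: pos => //; exact: addr_ge0.
  - move=> t; rewrite ?mule0 ?add0e {1}/H' patchE; case: ifPn; last first.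
      by move=> _; rewrite lee_fin; apply: pos => //; exact: addr_ge0.
    rewrite inE /D0 /= in_itv/= andbT => t0.
    have [t1|t1] := leP t 1%R.
      have tD : t \in D1 by rewrite inE /D1 /= in_itv/= t0.
      apply: le_trans (Hu t t0 t1) _; rewrite lee_fin /e1 /e2 !patchE tD.
      have := mulr_ge0 C0 (e30 t); lra.
    have tD : t \in D2 by rewrite inE /D2 /= in_itv/= andbT ltW.
    apply: le_trans (Ht t t1) _; rewrite lee_fin {1}/e3 patchE tD.
    have := mulr_ge0 (addr_ge0 l0 ce0) (e10 t); have := mulr_ge0 c0 (e20 t); lra.
have lo : (l * al^-1)%:E <= \int[mu]_t H' t + (c * e * al^-1 + c)%:E.
  have := @integral_le_affine _ _ R mu
    (fun t => (l * e1 t + (0 * e2 t + 0 * e3 t))%:E) H'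
    (fun t => c * e * e1 t + (c * e2 t + 0 * e3 t))%R 1.
  rewrite !lin// !addr0 mul1e; apply => //.
  - by move=> t; rewrite lee_fin ?mul0r ?addr0 mulr_ge0.
  - exact: meas.
  - by move=> t; exact: pos.
  - move=> t; rewrite ?mul1e ?mul0r ?addr0.
    have [tD|tD] := boolP (t \in D1); last first.
      rewrite /e1 /e2 !patchE (negbTE tD) !mulr0 ?addr0 ?adde0.
      exact: H'0.
    rewrite /e1 /e2 /H' !patchE tD.
    move: tD; rewrite inE /D1 /= in_itv/= => /andP[t0 t1].
    have -> : t \in D0 by rewrite inE /D0 /= in_itv/= t0.
    by rewrite mulr1; exact: Hl.
have E : \int[mu]_(t in `]0%R, +oo[) H t = \int[mu]_t H' t.
  by rewrite integral_mkcond.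
have I0 : 0 <= \int[mu]_t H' t by exact: integral_ge0.
rewrite E; move: up lo I0; case: (\int[mu]_t H' t) => [I||] //.
rewrite -EFinD !lee_fin => up lo I0; exists I => //; split => //.
have aln0 : al != 0%R by rewrite gt_eqF.
have up' : (al * I <= l + c * e + al * (c + C))%R.
  have := ler_wpM2l (ltW al0) up; rewrite mulrDr mulrCA divff// mulr1; lra.
have lo' : (l <= al * I + c * e + al * c)%R.
  have := ler_wpM2l (ltW al0) lo; rewrite !mulrDr ![(al * (_ * al^-1))%R]mulrCA divff// !mulr1; lra.
have alC : (0 <= al * C)%R by rewrite mulr_ge0// ltW.
rewrite ler_norml; apply/andP; split; lra.
Qed.

End OuterIntegral.

(** * Difference quotients of [f] and the seminorm for fixed [p] *)

Section DifferenceQuotients.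
Variables (R : realType) (n : nat) (xi : 'rV[R]_n) (f : 'rV[R]_n -> R).

Lemma C2c_quotient_bounds : C2c f -> exists M r C : R,
  [/\ 1 <= M, 0 <= r & 0 <= C] /\
  [/\ forall x, `|grad_dot f x xi| <= M,
      forall t (x : 'rV[R]_n), 0 < t -> `|Delta (t *: xi) f x| <= t * M,
      forall t x, `|Delta (t *: xi) f x| <= M,
      forall t (x : 'rV[R]_n), 0 < t -> `| `|Delta (t *: xi) f x| / t - `|grad_dot f x xi| | <= C * t &
      forall t (x : 'rV[R]_n), 0 < t ->
        [/\ t <= 1 -> ~ (forall i, `|x 0 i| <= r) ->
              Delta (t *: xi) f x = 0 /\ grad_dot f x xi = 0 &
            ~ (forall i, `|x 0 i| <= r) -> ~ (forall i, `|x 0 i + t * xi 0 i| <= r) ->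
              Delta (t *: xi) f x = 0]].
Proof.
move=> C2; have [F [r [fF dF ddF fr dfr]]] := C2c_bounds R n f C2.
have [cf [df [cdf [ddf _]]]] := C2.
set S := sum_abs R n xi.
have S0 : 0 <= S by exact: sum_abs_ge0.
have F0 : 0 <= F by exact: le_trans (fF 0).
(* [F * S] bounds the directional derivative and the quotient, [2F] bounds the difference itself,
   and the summand 1 ensures [1 <= M]. The radius grows by [S] so that translations by [t *: xi]
   with [t <= 1] stay in the cube; [|r|] makes it nonnegative. [F * S ^+ 2] is the second-order
   remainder. *)
exists (1 + F * S + F *+ 2), (`|r| + S), (F * S ^+ 2).
have FS0 : 0 <= F * S by exact: mulr_ge0.
have xiS i : `|xi 0 i| <= S.
  by rewrite /S /sum_abs (bigD1 i)//= lerDl sumr_ge0.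
have rr : r <= `|r| + S by rewrite (le_trans (ler_norm r))// lerDl.
have box (x : 'rV[R]_n) : ~ (forall i, `|x 0 i| <= `|r| + S) -> f x = 0.
  move=> h; apply: contrapT => /eqP fx; apply: h => i.
  exact: le_trans (fr x fx i) rr.
have gradlin t x : grad_dot f x (t *: xi) = t * grad_dot f x xi.
  by rewrite /grad_dot mulr_sumr; apply: eq_bigr => i _; rewrite mxE; ring.
split; split.
- lra.
- by rewrite addr_ge0.
- by rewrite mulr_ge0// exprn_ge0.
- move=> x; apply: (@le_trans _ _ (F * S)); last lra.
  apply: (le_trans (ler_norm_sum _ _ _)); rewrite /S /sum_abs mulr_sumr.
  by apply: ler_sum => i _; rewrite normrM ler_wpM2r.
- move=> t x t0.
  apply: (le_trans (bounded_partials_lipschitz R n f F x (t *: xi) df dF)).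
  rewrite sum_absZ gtr0_norm// mulrCA ler_wpM2l ?(ltW t0)// -/S; lra.
- move=> t x; rewrite /Delta; apply: (le_trans (ler_normB _ _)).
  have := fF (x + t *: xi); have := fF x; lra.
- move=> t x t0.
  have h := increment_grad_dot R n f F x (t *: xi) df ddf ddF.
  rewrite -/(Delta _ _ _) gradlin sum_absZ (gtr0_norm t0) -/S in h.
  have tn0 : t != 0 by rewrite gt_eqF.
  have -> : `|Delta (t *: xi) f x| / t = `|Delta (t *: xi) f x / t|.
    by rewrite normrM normfV (gtr0_norm t0).
  apply: (le_trans (ler_dist_dist _ _)).
  have -> : Delta (t *: xi) f x / t - grad_dot f x xi =
      (Delta (t *: xi) f x - t * grad_dot f x xi) / t by field.
  rewrite normrM normfV (gtr0_norm t0) ler_pdivrMr//.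
  by apply: (le_trans h); rewrite exprMn; lra.
- move=> t x t0; split.
  + move=> t1 xb; split; last first.
      rewrite /grad_dot big1// => i _.
      have -> : partial i f x = 0; last by rewrite mul0r.
      apply: contrapT => /eqP h; apply: xb => j.
      exact: le_trans (dfr i x h j) rr.
    rewrite /Delta (box x)// subr0; apply: contrapT => /eqP h; apply: xb => i.
    have := fr _ h i; rewrite !mxE => h'.
    have -> : x 0 i = (x 0 i + t * xi 0 i) - t * xi 0 i by ring.
    apply: (le_trans (ler_normB _ _)); apply: lerD.
      exact: le_trans h' (ler_norm r).
    rewrite normrM gtr0_norm// (le_trans _ (xiS i))// ler_piMl//.
  + move=> xb xb'; rewrite /Delta (box x)// box ?subrr// => h.
    by apply: xb' => i; have := h i; rewrite !mxE.
Qed.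

Section Estimates.
Variables (M r C : R).
Hypotheses (M1 : 1 <= M) (r0 : 0 <= r) (C0 : 0 <= C).
Hypothesis grad_le : forall x, `|grad_dot f x xi| <= M.
Hypothesis Delta_le_t : forall t x, 0 < t -> `|Delta (t *: xi) f x| <= t * M.
Hypothesis Delta_le : forall t x, `|Delta (t *: xi) f x| <= M.
Hypothesis quotient_close : forall t x, 0 < t ->
  `| `|Delta (t *: xi) f x| / t - `|grad_dot f x xi| | <= C * t.
Hypothesis supports : forall t (x : 'rV[R]_n), 0 < t ->
  [/\ t <= 1 -> ~ (forall i, `|x 0 i| <= r) ->
        Delta (t *: xi) f x = 0 /\ grad_dot f x xi = 0 &
      ~ (forall i, `|x 0 i| <= r) -> ~ (forall i, `|x 0 i + t * xi 0 i| <= r) ->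
        Delta (t *: xi) f x = 0].
Hypothesis n2 : (2 <= n)%N.

Let nR : 2 <= n%:R :> R. Proof. by rewrite ler_nat. Qed.
Let V := (r *+ 2) ^+ n.
Let V0 : 0 <= V. Proof. by rewrite exprn_ge0// mulrn_wge0. Qed.
Let M0 : 0 <= M. Proof. exact: le_trans ler01 M1. Qed.
Let N p t : \bar R := int_Rn (fun x => (`|Delta (t *: xi) f x| `^ p)%:E).

Lemma Pi_star_n_fin : exists2 l : R, Pi_star_n f xi = l%:E & 0 <= l.
Proof.
have h0 x : (0 <= (`|grad_dot f x xi| ^+ n)%:E)%E by rewrite lee_fin exprn_ge0.
have : (Pi_star_n f xi <= (M ^+ n * V)%:E)%E.
  apply: (int_Rn_le_box R n _ 0 r) => //; first exact: exprn_ge0.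
    by move=> x _; rewrite lee_fin lerXn2r ?nnegrE.
  (* The vanishing of the gradient is packaged with that of a difference, so some [t <= 1] must be
     chosen; [t = 1] serves. *)
  move=> x xb; have [_ ->] : Delta (1 *: xi) f x = 0 /\ grad_dot f x xi = 0.
    have [h _] := supports 1 x ltr01; apply: h => // h; apply: xb => i.
    by rewrite mxE subr0.
  by rewrite normr0 expr0n; case: n n2.
have := int_Rn_ge0 R n _ h0; rewrite -/(Pi_star_n f xi).
by case: (Pi_star_n f xi) => [l||] //; rewrite lee_fin => l0 _; exists l.
Qed.

(** The first summand pays for replacing the exponent [p] by [n], the second for replacing the
    quotient by the derivative. *)
Let c := M `^ (n%:R + 2) + n%:R * M ^+ n * C.
Let c0 : 0 <= c.
Proof. by rewrite addr_ge0 ?powR_ge0// !mulr_ge0// exprn_ge0. Qed.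

Lemma integrand_close p t x : n%:R < p -> p <= n%:R + 1 -> 0 < t ->
  `| (`|Delta (t *: xi) f x| / t) `^ p - `|grad_dot f x xi| ^+ n |
    <= c * (p - n%:R + t).
Proof.
move=> np pn t0; have nR' := nR.
set D := _ / t; set G := `|grad_dot _ _ _|.
have D0 : 0 <= D by rewrite divr_ge0// ltW.
have DM : D <= M by rewrite ler_pdivrMr// mulrC Delta_le_t.
have h1 : `|D `^ p - D ^+ n| <= (p - n%:R) * M `^ (n%:R + 2).
  have := @powR_close R D M n%:R (p - n%:R) D0 DM M1.
  rewrite addrCA subrr addr0 powR_mulrn//; apply; lra.
have h2 : `|D ^+ n - G ^+ n| <= n%:R * M ^+ n * (C * t).
  apply: le_trans (@exprn_lipschitz R D G M n D0 DM (normr_ge0 _) (grad_le x) M1) _.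
  by rewrite ler_wpM2l ?quotient_close// mulr_ge0// exprn_ge0.
have -> : D `^ p - G ^+ n = (D `^ p - D ^+ n) + (D ^+ n - G ^+ n) by ring.
apply: (le_trans (ler_normD _ _)).
apply: (le_trans (lerD h1 h2)).
have a0 : 0 <= M `^ (n%:R + 2) by exact: powR_ge0.
have b0 : 0 <= n%:R * M ^+ n * C by rewrite !mulr_ge0// exprn_ge0.
have tp : 0 <= p - n%:R by lra.
have := mulr_ge0 a0 (ltW t0); have := mulr_ge0 b0 tp; rewrite /c; lra.
Qed.

Lemma N_close l p t : Pi_star_n f xi = l%:E -> n%:R < p -> p <= n%:R + 1 ->
  0 < t -> t <= 1 ->
  exists2 u : R, N p t = (t `^ p * u)%:E &
    0 <= u /\ `|u - l| <= c * V * (p - n%:R + t).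
Proof.
move=> hl np pn t0 t1; have nR' := nR.
have tp0 : 0 < t `^ p by exact: powR_gt0.
have tpn0 : t `^ p != 0 by rewrite gt_eqF.
have pn0 : p != 0 by apply/eqP; lra.
set e := c * (p - n%:R + t).
have e0 : 0 <= e by rewrite mulr_ge0//; lra.
have A0 x : (0 <= (`|Delta (t *: xi) f x| `^ p)%:E)%E by rewrite lee_fin powR_ge0.
have B0 x : (0 <= (`|grad_dot f x xi| ^+ n)%:E)%E by rewrite lee_fin exprn_ge0.
have AE x : `|Delta (t *: xi) f x| `^ p = t `^ p * (`|Delta (t *: xi) f x| / t) `^ p.
  rewrite -powRM ?divr_ge0 ?(ltW t0)//; congr (_ `^ _).
  by rewrite mulrCA divff ?mulr1// gt_eqF.
have out (x : 'rV[R]_n) : ~ (forall i, `|x ord0 i - (0 : 'rV[R]_n) ord0 i| <= r) ->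
    Delta (t *: xi) f x = 0 /\ grad_dot f x xi = 0.
  move=> xb; have [h _] := supports t x t0; apply: h => // h; apply: xb => i.
  by rewrite mxE subr0.
have n0 : (0 : R) ^+ n = 0 by rewrite expr0n; case: n n2.
(* The comparison is made in both directions, with factors [t^p] and [t^(-p)]. This first one also
   shows that [N p t] is finite, so that the rest is real arithmetic. *)
have up : (N p t <= (t `^ p)%:E * l%:E + (t `^ p * e * V)%:E)%E.
  rewrite -hl; apply: (int_Rn_le_affine R n _ _ 0 r) => //.
  - by rewrite mulr_ge0// ltW.
  - move=> x _; rewrite -EFinM -EFinD lee_fin AE -mulrDr ler_pM2l//.
    have := integrand_close p t x np pn t0; rewrite ler_norml => /andP[_ h].
    by rewrite /e; lra.
  - by move=> x /out[-> ->]; rewrite normr0 powR0// n0 mule0.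
have lo : (l%:E <= ((t `^ p)^-1)%:E * N p t + (e * V)%:E)%E.
  rewrite -hl; apply: (int_Rn_le_affine R n _ _ 0 r) => //.
  - by rewrite invr_gt0.
  - move=> x _; rewrite -EFinM -EFinD lee_fin AE mulrA mulVf// mul1r.
    have := integrand_close p t x np pn t0; rewrite ler_norml => /andP[h _].
    by rewrite /e; lra.
  - by move=> x /out[-> ->]; rewrite normr0 powR0// n0 mule0.
have := int_Rn_ge0 R n _ A0; rewrite -/(N p t).
move: up lo; case: (N p t) => [v||] //; rewrite -!EFinM -!EFinD !lee_fin => up lo v0.
exists ((t `^ p)^-1 * v); first by rewrite mulrA divff// mul1r.
have up' : (t `^ p)^-1 * v <= l + e * V.
  by rewrite ler_pdivrMl// mulrDr mulrA.
split; first by rewrite mulr_ge0// invr_ge0 ltW.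
have -> : c * V * (p - n%:R + t) = e * V by rewrite /e; ring.
by rewrite ler_norml; apply/andP; split; lra.
Qed.

Let C3 := M ^+ n.+1 * V *+ 2.
Let C30 : 0 <= C3.
Proof. by rewrite mulrn_wge0// mulr_ge0// exprn_ge0. Qed.

(** For large [t] no fixed cube contains the support of the difference, but two cubes of radius [r]
    do, centred at 0 and at [- (t *: xi)]. The first is carried by the comparison function [B], the
    second by the error term; hence the factor 2 in [C3]. *)
Lemma N_bounded p t : n%:R < p -> p <= n%:R + 1 -> 0 < t ->
  exists2 v : R, N p t = v%:E & 0 <= v /\ v <= C3.
Proof.
move=> np pn t0; have nR' := nR; have M0' := M0.
have pn0 : p != 0 by apply/eqP; lra.
have Mp : M `^ p <= M ^+ n.+1.
  by rewrite -powR_mulrn//; apply: ler_powR => //; rewrite -natr1.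
have M10 : 0 <= M ^+ n.+1 by exact: exprn_ge0.
have A0 x : (0 <= (`|Delta (t *: xi) f x| `^ p)%:E)%E by rewrite lee_fin powR_ge0.
have Ale x : `|Delta (t *: xi) f x| `^ p <= M ^+ n.+1.
  apply: le_trans Mp; apply: ge0_ler_powR; rewrite ?nnegrE//; lra.
pose in0 (x : 'rV[R]_n) := [forall i, `|x 0 i| <= r].
pose B x : \bar R := (M ^+ n.+1 * (in0 x)%:R)%:E.
have B0 x : (0 <= B x)%E by rewrite lee_fin mulr_ge0.
have hB : (int_Rn B <= (M ^+ n.+1 * V)%:E)%E.
  apply: (int_Rn_le_box R n _ 0 r) => //.
    by move=> x _; rewrite lee_fin ler_piMr// lern1 leq_b1.
  move=> x xb; rewrite /B; case: (boolP (in0 x)) => [/forallP h|_]; last by rewrite mulr0.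
  by exfalso; apply: xb => i; rewrite mxE subr0.
have hA : (N p t <= 1%:E * int_Rn B + (M ^+ n.+1 * V)%:E)%E.
  apply: (int_Rn_le_affine R n _ _ (- (t *: xi)) r) => //.
  - move=> x _; rewrite mul1e -EFinD lee_fin.
    by apply: (le_trans (Ale x)); rewrite lerDr mulr_ge0.
  - move=> x xb; rewrite mul1e lee_fin.
    case: (boolP (in0 x)) => [_|/forallP h]; first by rewrite mulr1.
    have [_ ->] := supports t x t0; rewrite ?normr0 ?powR0 ?mulr0//.
    by move=> h'; apply: xb => i; rewrite !mxE opprK.
rewrite mul1e in hA.
have {}hA : (N p t <= C3%:E)%E.
  apply: (le_trans hA); rewrite /C3 mulr2n EFinD.
  by rewrite leeD2r.
have := int_Rn_ge0 R n _ A0; rewrite -/(N p t).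
by move: hA; case: (N p t) => [v||] //; rewrite !lee_fin => hv v0; exists v.
Qed.

Lemma Pi_star_spq_close l : Pi_star_n f xi = l%:E -> 0 <= l ->
  exists K : R, forall p, n%:R < p -> p <= n%:R + 1 ->
  exists2 I : R, Pi_star_spq (n%:R / p) p n%:R f xi = I%:E &
    0 <= I /\ `|(1 - n%:R / p) * I - n%:R^-1 * l| <= K * (p - n%:R).
Proof.
move=> hl l0; have nR' := nR; have C30' := C30.
set c1 := c * V; have c10 : 0 <= c1 by rewrite mulr_ge0.
(* Since [p - n + t <= 2], [l + 2 c1] bounds the normalised integral [u] of [N_close]; adding 1
   makes the bound at least 1. In [c2], [c1] comes from [u - l] and the cube from [powR_close] with
   [m = 1]. *)
pose M' := l + c1 *+ 2 + 1.
have M'1 : 1 <= M' by rewrite /M'; lra.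
pose c2 := c1 + M' `^ 3.
have c20 : 0 <= c2 by rewrite addr_ge0// powR_ge0.
exists (c2 *+ 2 + (C3 + 1)) => p np pn.
set th := p - n%:R.
have p0 : 0 < p by lra.
have pn0 : p != 0 by rewrite gt_eqF.
have nn0 : n%:R != 0 :> R by apply/eqP; lra.
pose al := n%:R - n%:R * n%:R / p.
have alE : al = n%:R * (1 - n%:R / p) by rewrite /al; ring.
have np1 : n%:R / p < 1 by rewrite ltr_pdivrMr// mul1r.
have npos : 0 < n%:R / p by rewrite divr_gt0//; lra.
have al0 : 0 < al by rewrite alE mulr_gt0//; lra.
have pnE : p / n%:R - 1 = th / n%:R by rewrite /th; field.
have thn : th / n%:R <= th.
  rewrite ler_pdivrMr; last lra.
  by apply: ler_peMr; [rewrite /th; lra|lra].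
have thn0 : 0 <= th / n%:R.
  by apply: divr_ge0; [rewrite /th; lra|exact: ler0n].
have LpE v t : N p t = v%:E ->
    (Lp_norm p (Delta (t *: xi) f) `^ n%:R)%E = (v `^ (n%:R / p))%:E.
  move=> Nv; rewrite /Lp_norm -/(N p t) Nv !poweR_EFin -powRrM.
  by rewrite [p^-1 * _]mulrC.
have near0 t : 0 < t -> t <= 1 -> exists2 w : R,
    ((t `^ (- (n%:R / p * n%:R)))%:E * Lp_norm p (Delta (t *: xi) f) `^ n%:R
      * (t^-1)%:E = (t `^ (al - 1) * w)%:E)%E &
    `|w - l| <= c2 * (th + t).
  move=> t0 t1; have [u Nu [u0 ul]] := N_close l p t hl np pn t0 t1.
  exists (u `^ (n%:R / p)).
    rewrite (LpE _ _ Nu) -!EFinM; congr EFin.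
    rewrite powRM ?powR_ge0// -powRrM [p * _]mulrCA divff// mulr1.
    have -> : t `^ (al - 1) = t `^ (- (n%:R / p * n%:R)) * t `^ n%:R * t `^ (- 1).
      rewrite -!powRD ?(gt_eqF t0) ?implybT//; congr (_ `^ _); rewrite /al; field.
      exact: pn0.
    by rewrite powR_inv1 ?(ltW t0)//; ring.
  set w := u `^ _.
  have w0 : 0 <= w by exact: powR_ge0.
  have th1 : th + t <= 2 by rewrite /th; lra.
  have uM : u <= M'.
    have := ler_wpM2l c10 th1; move: ul; rewrite ler_norml => /andP[_ h].
    by rewrite /M'; rewrite -/th -/c1 in h; lra.
  have wM : w <= M'.
    apply: (@le_trans _ _ (M' `^ (n%:R / p))); last by apply: ler1_powR => //; exact: ltW.
    apply: ge0_ler_powR; rewrite ?nnegrE//; lra.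
  have wu : w `^ (p / n%:R) = u.
    by rewrite /w -powRrM mulrA divfK// divff// powRr1.
  (* The exponent [n/p] is below 1, outside the range of [powR_close]. The comparison is therefore
     read backwards, with base [w] and [u = w^(p/n)], where [p/n] lies between 1 and 2. *)
  have := @powR_close R w M' 1 (p / n%:R - 1) w0 wM M'1 (lexx _).
  rewrite [1 + (_ - 1)]addrC subrK powRr1// wu pnE => h.
  have {}h : `|u - w| <= th / n%:R * M' `^ (1 + 2).
    by apply: h => //; apply: (le_trans thn); rewrite /th; lra.
  have M30 : 0 <= M' `^ 3 by exact: powR_ge0.
  have E3 : 1 + 2 = 3 :> R by lra.
  rewrite E3 in h.
  have -> : w - l = (u - l) - (u - w) by ring.
  apply: (le_trans (ler_normB _ _)).
  have := ler_wpM2r M30 thn.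
  have := mulr_ge0 M30 (ltW t0).
  rewrite -/th -/c1 in ul; rewrite /c2; lra.
have tail t : 1 < t ->
    ((t `^ (- (n%:R / p * n%:R)))%:E * Lp_norm p (Delta (t *: xi) f) `^ n%:R
      * (t^-1)%:E <= ((C3 + 1) * t `^ (- 2))%:E)%E.
  move=> t1; have t0 : 0 < t by lra.
  have [v Nv [v0 vC]] := N_bounded p t np pn t0.
  rewrite (LpE _ _ Nv) -!EFinM lee_fin.
  rewrite -[t^-1]powR_inv1 ?(ltW t0)// mulrAC -powRD ?(gt_eqF t0) ?implybT// mulrC.
  apply: ler_pM; rewrite ?powR_ge0//.
    (* Adding 1 to [C3] gives a base at least 1, which a power [n/p < 1] does not increase. *)
    apply: (@le_trans _ _ ((C3 + 1) `^ (n%:R / p))).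
      apply: ge0_ler_powR; rewrite ?nnegrE//; lra.
    by apply: ler1_powR; lra.
  apply: ler_powR; first exact: ltW.
  (* Here [p <= n + 1 <= 2n <= n^2]. *)
  have : 1 <= n%:R / p * n%:R.
    rewrite mulrAC ler_pdivlMr// mul1r.
    have := ler_wpM2l (ler0n R n) nR; lra.
  lra.
have [|||||I HI [I0 hI]] := @outer_integral_estimate R
  (fun t => (t `^ (- (n%:R / p * n%:R)))%:E * Lp_norm p (Delta (t *: xi) f) `^ n%:R
      * (t^-1)%:E)%E al l c2 th (C3 + 1) al0 l0 c20 _ _ _ _ _ tail.
- by rewrite /th; lra.
- by lra.
- move=> t t0; rewrite mule_ge0// ?mule_ge0 ?lee_fin ?powR_ge0 ?poweR_ge0//.
  by rewrite invr_ge0 ltW.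
- move=> t t0 t1; have [w -> hw] := near0 t t0 t1; rewrite lee_fin.
  have ta0 : 0 <= t `^ (al - 1) by exact: powR_ge0.
  (* The error proportional to [t] absorbs the singular weight, as [t^al <= 1], and contributes only
     a constant. *)
  have ta1 : t * t `^ (al - 1) <= 1.
    rewrite mulr_powRB1 ?(ltW t0)//; apply: (@le_trans _ _ (1 `^ al)); last by rewrite powR1.
    apply: ge0_ler_powR; rewrite ?nnegrE//; lra.
  have h1 := ler_wpM2l c20 ta1.
  move: hw; rewrite ler_norml => /andP[_ h2].
  have := ler_wpM2r ta0 h2; lra.
- move=> t t0 t1; have [w -> hw] := near0 t t0 t1; rewrite -EFinD lee_fin.
  have ta0 : 0 <= t `^ (al - 1) by exact: powR_ge0.
  have ta1 : t * t `^ (al - 1) <= 1.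
    rewrite mulr_powRB1 ?(ltW t0)//; apply: (@le_trans _ _ (1 `^ al)); last by rewrite powR1.
    apply: ge0_ler_powR; rewrite ?nnegrE//; lra.
  have h1 := ler_wpM2l c20 ta1.
  move: hw; rewrite ler_norml => /andP[h2 _].
  have := ler_wpM2r ta0 h2; lra.
exists I; first exact: HI.
split => //.
have -> : (1 - n%:R / p) * I - n%:R^-1 * l = n%:R^-1 * (al * I - l).
  by rewrite alE; field; rewrite pn0 nn0.
have ni0 : 0 < n%:R^-1 :> R by rewrite invr_gt0; lra.
rewrite normrM (gtr0_norm ni0).
apply: (le_trans (ler_wpM2l (ltW ni0) hI)).
(* In fact [al = n * th / p] with [p >= 1]; this turns the errors proportional to [al] into
   multiples of [p - n]. *)
have alth : al <= n%:R * th.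
  rewrite alE ler_pM2l ?(lt_le_trans _ nR)//.
  have -> : 1 - n%:R / p = th / p by rewrite /th; field.
  rewrite ler_pdivrMr//; apply: ler_peMr; [rewrite /th; lra|lra].
have h1 := ler_wpM2r c20 alth.
have C31 : 0 <= C3 + 1 by lra.
have h2 := ler_wpM2r C31 alth.
have th0 : 0 <= th by rewrite /th; lra.
have h3 : c2 * th <= n%:R * (c2 * th) by rewrite ler_peMl ?mulr_ge0//; lra.
by rewrite mulrC ler_pdivrMr; lra.
Qed.

End Estimates.

End DifferenceQuotients.

(** * The outer power [p/n] and the limit *)

Theorem mainTheorem15 (R : realType) (n : nat) (xi : 'rV[R]_n)
    (f : 'rV[R]_n -> R) :
  (2 <= n)%N -> unit_sphere xi -> C2c f ->
  (((1 - n%:R / p) `^ (p / n%:R))%:E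
     * (Pi_star_spq (n%:R / p) p n%:R f xi) `^ (p / n%:R))%E
    @[p --> (n%:R : R)^'+] --> ((n%:R)^-1%:E * Pi_star_n f xi)%E.
Proof.
move=> n2 _ C2.
have nR : 2 <= n%:R :> R by rewrite ler_nat.
have [M [r [C [[M1 r0 C0] [h1 h2 h3 h4 h5]]]]] := C2c_quotient_bounds R n xi f C2.
have [l hl l0] := Pi_star_n_fin R n xi f M r M1 r0 h1 h5 n2.
have [K hK] := Pi_star_spq_close R n xi f M r C M1 r0 C0 h1 h2 h3 h4 h5 n2 l hl l0.
rewrite hl -EFinM; set m := _ * l.
have m0 : 0 <= m by rewrite mulr_ge0// invr_ge0.
(* As [p - n <= 1], [m + |K|] bounds [X = (1 - n/p) * I]. The absolute value is taken because [K]
   has no known sign, and the summand 1 meets the requirement of [powR_close]. *)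
pose B := m + `|K| + 1.
have K0 : 0 <= `|K| by [].
have B1 : 1 <= B by rewrite /B; lra.
have B30 : 0 <= B `^ 3 by exact: powR_ge0.
pose Q := `|K| + B `^ 3 + 1.
have key p : n%:R < p -> p <= n%:R + 1 -> exists2 v : R,
    (((1 - n%:R / p) `^ (p / n%:R))%:E
     * (Pi_star_spq (n%:R / p) p n%:R f xi) `^ (p / n%:R))%E = v%:E &
    `|m - v| <= Q * (p - n%:R).
  move=> np pn; have [I -> [I0 hI]] := hK p np pn.
  have p0 : 0 < p by lra.
  have nn0 : n%:R != 0 :> R by apply/eqP; lra.
  set X := (1 - n%:R / p) * I in hI.
  have s0 : 0 <= 1 - n%:R / p by rewrite subr_ge0 ler_pdivrMr// mul1r ltW.
  have X0 : 0 <= X by rewrite mulr_ge0.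
  have th0 : 0 <= p - n%:R by lra.
  have {}hI : `|X - m| <= `|K| * (p - n%:R).
    by apply: (le_trans hI); rewrite ler_wpM2r// ler_norm.
  have Kth : `|K| * (p - n%:R) <= `|K| by apply: ler_piMr => //; lra.
  have XB : X <= B.
    have := le_trans (ler_norm _) hI; rewrite /B; lra.
  exists (X `^ (p / n%:R)).
    by rewrite poweR_EFin -EFinM /X powRM.
  have pnE : p / n%:R - 1 = (p - n%:R) / n%:R by field.
  have thn : (p - n%:R) / n%:R <= p - n%:R.
    rewrite ler_pdivrMr; last lra.
    by apply: ler_peMr; lra.
  have thn0 : 0 <= (p - n%:R) / n%:R by exact: divr_ge0.
  have := @powR_close R X B 1 (p / n%:R - 1) X0 XB B1 (lexx _).
  rewrite [1 + (_ - 1)]addrC subrK powRr1// pnE => h.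
  have {}h : `|X `^ (p / n%:R) - X| <= (p - n%:R) / n%:R * B `^ (1 + 2).
    by apply: h => //; apply: (le_trans thn); lra.
  have E3 : 1 + 2 = 3 :> R by lra.
  rewrite E3 in h.
  have -> : m - X `^ (p / n%:R) = - ((X - m) + (X `^ (p / n%:R) - X)) by ring.
  rewrite normrN; apply: (le_trans (ler_normD _ _)).
  have := ler_wpM2r B30 thn; rewrite /Q; lra.
have Q0 : 0 < Q by rewrite /Q; lra.
(* Convergence in the extended reals splits into eventual finiteness and a real limit; [key] gives
   both. *)
apply: cvg_EFin.
  near=> p.
  have np : n%:R < p by near: p; exact: nbhs_right_gt.
  have pn : p <= n%:R + 1 by near: p; apply: nbhs_right_le; rewrite ltrDl.
  by have [v -> _] := key p np pn.
apply/cvgrPdist_le => e e0; near=> p.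
have np : n%:R < p by near: p; exact: nbhs_right_gt.
have pn : p <= n%:R + 1 by near: p; apply: nbhs_right_le; rewrite ltrDl.
have [v E hv] := key p np pn; rewrite /= E /=.
apply: (le_trans hv); rewrite mulrC -ler_pdivlMr// lerBlDl.
by near: p; apply: nbhs_right_le; rewrite ltrDl divr_gt0.
Unshelve. all: by end_near. Qed.
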